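(* Let $n \geq 9$ and let $k \in \{1, 2, \dotsc, \lfloor n/2 \rfloor\}$. Then there exists a constant $a_k = \frac{n}{k} + \alpha_k$ with $|\alpha_k| \leq \frac{10}{n}$ such that \[ P_k^\circ - Z \;\subset\; T_n - Z \;\subset\; a_k\,(P_k^\circ - Z). \]
   Context: Let $N = n(n-1)/2$ and index the coordinates of $\mathbb{R}^N$ by unordered pairs $\{i,j\}$ of distinct elements of $\{1,\dotsc,n\}$. Let $X \subset \mathbb{R}^N$ be the set of incidence vectors of Hamiltonian cycles of $K_n$ ($x_{ij}=1$ if the cycle uses edge $\{i,j\}$, else $0$). The symmetric traveling salesman polytope is $T_n = \operatorname{conv}(X)$, and $Z$ is its barycenter, the vector with all coordinates equal to $\frac{2}{n-1}$. For a function $f:X\to\mathbb{R}$, let $q_f(h) = \frac{1}{|X|}\sum_{x\in X} f(x)h(x)^2$ be the associated quadratic form on the space of real polynomials of degree at most $k$ on $\mathbb{R}^N$. Let $P_k$ be the set of linear functions $g$ on $\mathbb{R}^N$ (considered via their restriction to $X$) with average value $1$ on $X$ such that $q_g$ is positive semidefinite on polynomials of degree at most $k$. Define $P_k^\circ$ to be the set of points $z$ in the affine span of $X$ such that $g(z) \ge 0$ for all $g \in P_k$. *)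

(* Defs.v *)
From HB Require Import structures.
From mathcomp Require Import all_boot all_order all_fingroup all_algebra.
From mathcomp Require Import mpoly.
From mathcomp Require Import reals.

Set Implicit Arguments.
Unset Strict Implicit.
Unset Printing Implicit Defensive.

Import Order.TTheory GRing.Theory Num.Theory.
Local Open Scope ring_scope.

(* Coordinates of R^N, N = n(n-1)/2: unordered pairs {i,j} of distinct
   vertices of K_n, i.e. 2-element subsets of 'I_n. *)
Definition edge (n : nat) := {e : {set 'I_n} | #|e| == 2%N}.

Definition ham_edges (n : nat) (s : {perm 'I_n}) : {set {set 'I_n}} :=
  [set [set s i; s (ordS i)] | i : 'I_n].

Definition ham_cycles (n : nat) : {set {set {set 'I_n}}} :=
  [set ham_edges s | s : {perm 'I_n}].

Section Defs.
Variables (R : realType) (n : nat).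

Definition incid (C : {set {set 'I_n}}) : edge n -> R :=
  fun e => ((val e) \in C)%:R.

Definition avgX (F : (edge n -> R) -> R) : R :=
  (#|ham_cycles n|%:R)^-1 * \sum_(C in ham_cycles n) F (incid C).

(* Barycenter Z of T_n. *)
Definition Zbar : edge n -> R := fun _ => 2 / (n.-1)%:R.

Definition in_Tn (z : edge n -> R) : Prop :=
  exists lam : {set {set 'I_n}} -> R,
    (forall C, C \in ham_cycles n -> 0 <= lam C) /\
    \sum_(C in ham_cycles n) lam C = 1 /\
    forall e, z e = \sum_(C in ham_cycles n) lam C * incid C e.

Definition in_aff (z : edge n -> R) : Prop :=
  exists mu : {set {set 'I_n}} -> R,
    \sum_(C in ham_cycles n) mu C = 1 /\
    forall e, z e = \sum_(C in ham_cycles n) mu C * incid C e.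

Definition linf (c : edge n -> R) (x : edge n -> R) : R :=
  \sum_e c e * x e.

Definition peval (h : {mpoly R[#|{: edge n}|]}) (x : edge n -> R) : R :=
  h.@[fun i => x (enum_val i)].

Definition qform (f : (edge n -> R) -> R) (h : {mpoly R[#|{: edge n}|]}) : R :=
  avgX (fun x => f x * (peval h x) ^+ 2).

Definition in_Pk (k : nat) (c : edge n -> R) : Prop :=
  avgX (linf c) = 1 /\
  forall h : {mpoly R[#|{: edge n}|]}, (msize h <= k.+1)%N ->
    0 <= qform (linf c) h.

Definition in_Pk_polar (k : nat) (z : edge n -> R) : Prop :=
  in_aff z /\ forall c, in_Pk k c -> 0 <= linf c z.

End Defs.
Arguments Zbar : clear implicits.

(* Main.v *)
(** A linear [c] that is non-negative on [X] is, after normalisation, in [P_k];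
so Farkas' lemma gives the first inclusion.  For the second one it suffices to
write, for each Hamiltonian cycle [x0], the point [Z + (x0 - Z) / a] as an
average of points [E(x | S \subset x)] with [#|S| <= k]: such a conditional mean
is obtained by tilting the uniform law on [X] by the square of a monomial of
degree at most [k], hence lies in the polar of [P_k].  Take [S] to be [k] random
edges of a random (near-)perfect matching contained in [x0].  For a matching [S]
and [uv] not in [S],
[P(uv \in x | S \subset x) = (2 - d_S u) (2 - d_S v) / (2 (n - 1 - k))];
the average of this over [S] is the same for all pairs not in [x0], because two
vertices that are not adjacent in [x0] are never matched together, and it is the
same for all edges of [x0] by rotation.  This forces the average onto the line
through [Z] and [x0], and determines [a]. *)

Require Import Defs.
From HB Require Import structures.
From mathcomp Require Import all_boot all_order all_fingroup all_algebra.
From mathcomp Require Import mpoly.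
From mathcomp Require Import boolp reals.
From mathcomp Require Import zify ring lra.
Import Order.TTheory GRing.Theory Num.Theory.
Local Open Scope ring_scope.

Set Implicit Arguments.
Unset Strict Implicit.
Unset Printing Implicit Defensive.

(** * Hamiltonian cycles through a given set of edges *)

Lemma natr_negb (R : pzRingType) (b : bool) : (~~ b)%:R = 1 - b%:R :> R.
Proof. by case: b; rewrite ?subr0 ?subrr. Qed.

Lemma ordS_add1 (p : nat) (i : 'I_p.+2) : ordS i = i + 1.
Proof. by apply: val_inj; rewrite /= [(1 %% _)%N]modn_small // addn1. Qed.

Lemma set2_inj (T : finType) (a b c d : T) :
  [set a; b] = [set c; d] -> (a = c /\ b = d) \/ (a = d /\ b = c).
Proof.
move=> E.
have: a \in [set c; d] by rewrite -E set21.
have: b \in [set c; d] by rewrite -E set22.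
have: c \in [set a; b] by rewrite E set21.
have: d \in [set a; b] by rewrite E set22.
rewrite !inE; do 4 case/orP=> /eqP ?; subst; auto.
Qed.

Section Cyc.
Variables (p : nat) (T : finType).
Implicit Types f : 'I_p.+3 -> T.

Definition cyc_edge f (i : 'I_p.+3) : {set T} := [set f i; f (i + 1)].
Definition cyc f : {set {set T}} := [set cyc_edge f i | i : 'I_p.+3].

Lemma cyc_edge_inj f : injective f -> injective (cyc_edge f).
Proof.
move=> f_inj i j /set2_inj[[/f_inj-> //]|[/f_inj-> /f_inj]].
(* If the endpoints match crosswise, then [1 + 1 = 0] modulo [p.+3], which is impossible since the
   cycle has at least three vertices. *)
rewrite -addrA -[RHS]addr0 => /addrI/(congr1 val) /=.
by rewrite !modn_small.
Qed.

Lemma card_cyc f : injective f -> #|cyc f| = p.+3.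
Proof. by move=> f_inj; rewrite card_imset ?card_ord //; apply: cyc_edge_inj. Qed.

Lemma cyc_edgeD f j i : cyc_edge (fun i => f (j + i)) i = cyc_edge f (j + i).
Proof. by rewrite /cyc_edge addrA. Qed.

Lemma cycD f j : cyc (fun i => f (j + i)) = cyc f.
Proof.
apply/setP=> e; apply/imsetP/imsetP=> -[i _ ->].
  by exists (j + i); rewrite ?cyc_edgeD.
by exists (i - j); rewrite ?cyc_edgeD // addrC subrK.
Qed.
End Cyc.

Lemma ham_edgesE (p : nat) (s : 'S_p.+3) : ham_edges s = cyc s.
Proof. by apply: eq_imset => i; rewrite /cyc_edge ordS_add1. Qed.

Lemma card_ham_edge (p : nat) (s : 'S_p.+3) (e : {set 'I_p.+3}) :
  e \in ham_edges s -> #|e| == 2%N.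
Proof.
rewrite ham_edgesE => /imsetP[i _ ->]; rewrite cards2 (inj_eq perm_inj).
by rewrite -subr_eq0 opprD addrA subrr sub0r oppr_eq0 oner_eq0.
Qed.

Section Rot.
Variable p : nat.
(** Permutation products act left to right, so [(rot_perm j * s)%g] rotates positions before [s]
    labels them: only the starting vertex of the cycle changes. *)
Definition rot_perm (j : 'I_p.+3) : 'S_p.+3 := perm (@addrI _ j).
Lemma rot_permE j i : rot_perm j i = j + i.
Proof. by rewrite permE. Qed.

Lemma ham_edges_rot j (s : 'S_p.+3) : ham_edges (rot_perm j * s)%g = ham_edges s.
Proof.
rewrite !ham_edgesE -[RHS](cycD _ j); apply: eq_imset => i.
by rewrite /cyc_edge !permM !rot_permE.
Qed.

Definition rot_but_last (j : 'I_p.+3) : 'S_p.+4 := lift_perm ord_max ord_max (rot_perm j).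
Lemma rot_but_last_lift j i : rot_but_last j (lift ord_max i) = lift ord_max (j + i).
Proof. by rewrite lift_perm_lift rot_permE. Qed.
Lemma rot_but_last_max j : rot_but_last j ord_max = ord_max.
Proof. by rewrite lift_perm_id. Qed.
End Rot.

(** * Inserting a vertex into a shorter cycle *)

Section Pendant.
Variables (R : realFieldType) (p : nat).
Local Notation n := p.+4.
Implicit Types (S : {set {set 'I_n}}) (s : 'S_n).

(* Up to the constant number [2n] of orderings of a cycle, [nperm S] counts the
   Hamiltonian cycles that contain [S]. *)
Definition nperm S : R := \sum_(s : 'S_n) (S \subset ham_edges s)%:R.
Definition deg S (t : 'I_n) : nat := #|[set e in S | t \in e]|.

(* The vertices visited before the last one, [s ord_max], form a shorter cycle. *)
Definition link s (i : 'I_p.+3) : 'I_n := s (lift ord_max i).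

Lemma link_inj s : injective (link s).
Proof. by move=> i j /perm_inj/lift_inj. Qed.

(** The position [-1] is the last one of the short cycle. Only there do the successors in the short
    and the long cycle differ, because the vertex at [ord_max] sits between [-1] and [0]. *)
Lemma lift_max_add1 (i : 'I_p.+3) : i != -1 -> lift ord_max (i + 1) = lift ord_max i + 1.
Proof.
move=> iN1; have ip : (i < p.+2)%N.
  rewrite ltn_neqAle -ltnS ltn_ord andbT; apply: contraNneq iN1 => E.
  by apply/eqP/val_inj; rewrite /= E (modn_small (m := 1)) // subn1 modn_small.
apply: val_inj; rewrite /= /bump ![(1 %% _)%N]modn_small //.
by rewrite !modn_small /=; lia.
Qed.

Lemma lift_max_N1 : lift ord_max (-1 : 'I_p.+3) + 1 = ord_max.
Proof.
apply: val_inj; rewrite /= /bump ![(1 %% _)%N]modn_small // subn1 /=.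
by rewrite [(p.+2 %% _)%N]modn_small //= modn_small; lia.
Qed.

Lemma max_add1 : (ord_max : 'I_n) + 1 = lift ord_max (0 : 'I_p.+3).
Proof. by apply: val_inj; rewrite /= addn1 /bump modnn. Qed.

(** Deleting [w] replaces its two edges by the closing edge of [link s], which is the only edge of
    the short cycle missing from the long one. *)
Lemma sub_ham_link S s w : s ord_max = w -> (forall e, e \in S -> w \notin e) ->
  (S \subset ham_edges s) =
  (S \subset cyc (link s)) && (cyc_edge (link s) (-1) \notin S).
Proof.
move=> sw wS; rewrite ham_edgesE; apply/subsetP/andP => [H|[/subsetP H cl] e eS].
  have K e : e \in S -> exists2 i, i != -1 & e = cyc_edge (link s) i.
    move=> eS; have /imsetP[i _ ei] := H e eS; have := wS e eS; rewrite ei.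
    rewrite /cyc_edge !inE negb_or -sw !(inj_eq perm_inj).
    case: (unliftP ord_max i) => [j ->|->]; rewrite ?eqxx // => /andP[_].
    case: (eqVneq j (-1)) => [->|jN1]; first by rewrite lift_max_N1 eqxx.
    by move=> _; exists j => //; rewrite /link lift_max_add1.
  split; first by apply/subsetP=> e /K[i _ ->]; apply: imset_f.
  by apply/negP=> /K[i iN1 /(cyc_edge_inj (@link_inj s)) E]; rewrite -E eqxx in iN1.
have /imsetP[i _ ei] := H e eS; apply/imsetP; exists (lift ord_max i) => //.
rewrite ei /cyc_edge /link -lift_max_add1 //.
by apply: contraNneq cl => <-; rewrite -ei.
Qed.

Lemma pendant_ham_link s t w : s ord_max = w -> t != w ->
  ([set t; w] \in ham_edges s) = (link s 0 == t) || (link s (-1) == t).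
Proof.
move=> sw tw; rewrite ham_edgesE; apply/imsetP/orP => [[i _]|].
  rewrite -sw /cyc_edge; case: (unliftP ord_max i) => [j ->|->].
    case/set2_inj=> [] [-> /perm_inj E]; last by move: E => /eqP; rewrite (negPf (neq_lift _ _)).
    right; case: (eqVneq j (-1)) => [->|jN1] //.
    by move: E; rewrite -lift_max_add1 // => /eqP; rewrite (negPf (neq_lift _ _)).
  rewrite max_add1; case/set2_inj=> [] [-> /perm_inj E]; last by left.
  by move: E => /eqP; rewrite (negPf (neq_lift _ _)).
case=> /eqP <-; rewrite -sw.
  by exists ord_max => //; rewrite /cyc_edge max_add1 setUC.
by exists (lift ord_max (-1)) => //; rewrite /cyc_edge lift_max_N1.
Qed.

(* Rotating the cycle, [w] may be assumed to be the last vertex. *)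
Lemma nperm_last S w :
  nperm S = n%:R * \sum_(s : 'S_n | s ord_max == w) (S \subset ham_edges s)%:R.
Proof.
rewrite /nperm (partition_big (fun s : 'S_n => (s^-1)%g w) xpredT) //=.
rewrite (eq_bigr (fun _ => \sum_(s : 'S_n | s ord_max == w) (S \subset ham_edges s)%:R)).
  by rewrite sumr_const card_ord mulr_natl.
move=> i _; rewrite (reindex_inj (mulgI (rot_perm (ord_max - i)))) /=.
apply: eq_big => [s|s _]; last by rewrite ham_edges_rot.
rewrite -(inj_eq (@perm_inj _ (rot_perm (ord_max - i) * s)%g)) permKV permM.
by rewrite rot_permE subrK eq_sym.
Qed.

(** Averaging over the rotations of the short cycle lets [w] be inserted into each of its edges in
    turn. *)
Lemma sum_last_rot (F : ('I_p.+3 -> 'I_n) -> R) w :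
  p.+3%:R * (\sum_(s : 'S_n | s ord_max == w) F (link s)) =
  \sum_(s : 'S_n | s ord_max == w) \sum_j F (link (rot_but_last j * s)%g).
Proof.
rewrite exchange_big /= [RHS](eq_bigr (fun _ => \sum_(s : 'S_n | s ord_max == w) F (link s))).
  by rewrite sumr_const card_ord mulr_natl.
move=> j _; rewrite [RHS](reindex_inj (mulgI (rot_but_last j))) /=.
by apply: eq_bigl => s; rewrite permM rot_but_last_max.
Qed.

Lemma link_rot s j i : link (rot_but_last j * s)%g i = link s (j + i).
Proof. by rewrite /link permM rot_but_last_lift. Qed.

Lemma cyc_link_rot s j : cyc (link (rot_but_last j * s)%g) = cyc (link s).
Proof.
by rewrite -[RHS](cycD _ j); apply: eq_imset => i; rewrite /cyc_edge !link_rot.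
Qed.

Lemma cyc_edge_link_rot s j i :
  cyc_edge (link (rot_but_last j * s)%g) i = cyc_edge (link s) (j + i).
Proof. by rewrite -[RHS]cyc_edgeD /cyc_edge !link_rot. Qed.

Lemma sum_mem_cyc s S (F : {set 'I_n} -> R) : S \subset cyc (link s) ->
  \sum_j (cyc_edge (link s) j \in S)%:R * F (cyc_edge (link s) j) =
  \sum_(e in S) F e.
Proof.
move=> Scyc.
transitivity (\sum_(e in cyc (link s)) (e \in S)%:R * F e).
  by rewrite /cyc big_imset //= => i j _ _ /(cyc_edge_inj (@link_inj s)).
rewrite big_mkcond [RHS]big_mkcond; apply: eq_bigr => e _.
case: (boolP (e \in S)) => [/(subsetP Scyc) ->|_]; first by rewrite mul1r.
by rewrite mul0r; case: ifP.
Qed.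

(* A cycle through [S] arises by inserting [w] into one of the [n - 1 - #|S|]
   edges outside [S] of a cycle through [S] on the other vertices; [2 - deg S t]
   of these edges are at [t]. *)
Lemma nperm_pendant S t w : (forall e, e \in S -> w \notin e) -> t != w ->
  (p.+3%:R - #|S|%:R) * nperm ([set t; w] |: S) = (2 - (deg S t)%:R) * nperm S.
Proof.
move=> wS tw; rewrite !(nperm_last _ w) !(mulrCA _ n%:R); congr (_ * _).
(* [F1] and [F2] test, on the short cycle, whether the long one contains [S], respectively [S] and
   the new edge. Both counts become multiples of [A], the number of orderings whose short cycle
   contains [S]. *)
pose F1 (f : 'I_p.+3 -> 'I_n) : R :=
  ((S \subset cyc f) && (cyc_edge f (-1) \notin S))%:R.
pose F2 (f : 'I_p.+3 -> 'I_n) : R := F1 f * ((f 0 == t)%:R + (f (-1) == t)%:R).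
pose A : R := \sum_(s : 'S_n | s ord_max == w) (S \subset cyc (link s))%:R.
have E1 : p.+3%:R * \sum_(s : 'S_n | s ord_max == w) (S \subset ham_edges s)%:R =
          (p.+3%:R - #|S|%:R) * A.
  under eq_bigr => s /eqP sw do rewrite (sub_ham_link sw wS) -/(F1 _).
  rewrite sum_last_rot mulr_sumr; apply: eq_bigr => s _.
  under eq_bigr => j _ do rewrite /F1 cyc_link_rot cyc_edge_link_rot.
  case: (boolP (S \subset _)) => [Sc|_] /=; last by rewrite big1 // mulr0.
  (* After rotation by [j + 1] the closing edge is edge [j], so the favourable rotations are the
     positions with edge outside [S]. *)
  rewrite mulr1 (reindex_inj (addIr 1)) /=.
  under eq_bigr => j _ do rewrite addrK natr_negb.
  rewrite sumrB sumr_const card_ord; congr (_ - _).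
  have := sum_mem_cyc (fun _ => 1) Sc; rewrite sumr_const => <-.
  by apply: eq_bigr => j _; rewrite mulr1.
have E2 : p.+3%:R * \sum_(s : 'S_n | s ord_max == w) ([set t; w] |: S \subset ham_edges s)%:R =
          (2 - (deg S t)%:R) * A.
  (* The ends [0] and [-1] of the short cycle carry distinct vertices, so the disjunction of
     [pendant_ham_link] is a sum of indicators. *)
  rewrite (eq_bigr (fun s => F2 (link s))); last first.
    move=> s /eqP sw; rewrite subUset sub1set (pendant_ham_link sw tw) (sub_ham_link sw wS).
    rewrite -mulnb natrM mulrC -/(F1 _) /F2; congr (_ * _).
    case: eqP => [<-|_]; last by rewrite add0r.
    by rewrite (inj_eq (@link_inj s)) oppr_eq0 oner_eq0 addr0.
  rewrite sum_last_rot mulr_sumr; apply: eq_bigr => s /eqP sw.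
  under eq_bigr => j _ do rewrite /F2 /F1 cyc_link_rot cyc_edge_link_rot !link_rot addr0.
  case: (boolP (S \subset _)) => [Sc|_] /=; last by rewrite big1 ?mulr0 // => i _; rewrite mul0r.
  rewrite mulr1 (reindex_inj (addIr 1)) /=.
  have [i ti] : exists i, link s i = t.
    exists (odflt 0 (unlift ord_max ((s^-1)%g t))); rewrite /link.
    case: unliftP => [i <-|/(congr1 s)]; rewrite permKV // sw => tw'.
    by rewrite tw' eqxx in tw.
  (* Two edges of the short cycle are at [t]; those in [S], [deg S t] in number, are subtracted
     below. *)
  have sum_end : \sum_j ((link s (j + 1) == t)%:R + (link s j == t)%:R) = 2 :> R.
    rewrite big_split /=.
    have <- : \sum_j (link s j == t)%:R = \sum_j (link s (j + 1) == t)%:R :> R.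
      by rewrite (reindex_inj (addIr 1)).
    rewrite (bigD1 i) //= ti eqxx big1 => [|j ji]; last first.
      by rewrite -ti (inj_eq (@link_inj s)) (negPf ji).
    by rewrite addr0.
  have := sum_mem_cyc (fun e : {set 'I_n} => (t \in e)%:R) Sc.
  have -> : \sum_(e in S) (t \in e)%:R = (deg S t)%:R :> R.
    rewrite /deg -sum1dep_card natr_sum big_mkcondr.
    by apply: eq_bigr => e _; case: (t \in e).
  move=> <-; rewrite -sum_end -sumrB; apply: eq_bigr => j _.
  rewrite addrK natr_negb mulrBl mul1r; congr (_ - _ * _).
  rewrite /cyc_edge !inE ![t == _]eq_sym addrC.
  case: eqP => [<-|_] /=; last by rewrite add0r.
  by rewrite (inj_eq (@link_inj s)) -subr_eq0 addrAC subrr add0r oner_eq0 addr0.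
have n0 : p.+3%:R != 0 :> R by rewrite pnatr_eq0.
by apply: (mulfI n0); rewrite mulrCA E2 [RHS]mulrCA E1; ring.
Qed.
End Pendant.

(** * Adding an edge to a matching *)

Section Matching.
Variables (R : realFieldType) (p : nat).
Local Notation n := p.+4.
Implicit Types (S : {set {set 'I_n}}) (s : 'S_n).
Local Notation nperm := (nperm R).

Definition matching S := trivIset S /\ forall e, e \in S -> #|e| = 2%N.

Lemma deg_matching S t : matching S -> deg S t = (t \in cover S).
Proof.
move=> [tS _]; case: (boolP (t \in cover S)) => [tc|tc]; last first.
  apply/eqP; rewrite cards_eq0; apply/eqP/setP=> e; rewrite !inE.
  by apply/negP=> /andP[eS te]; case/negP: tc; apply/bigcupP; exists e.
rewrite /deg; suff -> : [set e in S | t \in e] = [set pblock S t] by rewrite cards1.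
apply/setP=> e; rewrite !inE; apply/andP/eqP => [[eS te]|->].
  by rewrite (def_pblock tS eS te).
by rewrite pblock_mem // mem_pblock.
Qed.

Lemma coverP S t : reflect (exists2 e, e \in S & t \in e) (t \in cover S).
Proof. exact: bigcupP. Qed.

(** If an endpoint is uncovered, [nperm_pendant] applies directly. If both are covered, remove the
    edge [[set v; v']] of [S] at [v]; then [v] and [v'] are free, and the edges at them can be
    restored in either order, each time as a pendant edge. *)
Lemma nperm_matching S u v : matching S -> u != v -> [set u; v] \notin S ->
  (#|S| < n)%N ->
  2 * (p.+3%:R - #|S|%:R) * nperm ([set u; v] |: S) =
  (2 - (u \in cover S)%:R) * (2 - (v \in cover S)%:R) * nperm S.
Proof.
move=> mS; wlog vc : u v / (u \in cover S -> v \in cover S).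
  move=> H uv uvS Sn; case: (boolP (v \in cover S)) => [vc|vc]; first by rewrite H ?vc.
  by rewrite (setUC [set u]) [X in _ = X * _]mulrC H ?(negPf vc) 1?eq_sym ?[[set v] :|: _]setUC.
move=> uv uvS Sn; have free S' w : w \notin cover S' -> forall e, e \in S' -> w \notin e.
  by move=> wc e eS; apply: contra wc => we; apply/coverP; exists e.
case: (boolP (u \in cover S)) vc => [uc /(_ isT) vc|uc _]; last first.
  have := nperm_pendant R (free _ _ uc) (t := v); rewrite eq_sym => /(_ uv).
  by rewrite (deg_matching _ mS) [[set v; u]]setUC => E; rewrite -mulrA E subr0; ring.
rewrite vc; have [e eS ve] := coverP _ _ vc.
have [v' v'v ee] : exists2 v', v' != v & e = [set v; v'].
  have /eqP/cards2P[a [b [ab ee]]] := mS.2 e eS; move: ve; rewrite ee !inE.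
  case/orP=> /eqP ->; first by exists b => //; rewrite eq_sym.
  by exists a => //; rewrite setUC.
subst e; pose S1 := S :\ [set v; v'].
have SE : S = [set v; v'] |: S1 by rewrite setD1K.
have uv' : u != v'.
  by apply: contraNneq uvS => ->; rewrite setUC.
have dis e x : e \in S1 -> x \in [set v; v'] -> x \notin e.
  rewrite !inE => /andP[ne eS'] xv; apply: contra ne => xe.
  rewrite -(def_pblock mS.1 eS' xe) -(def_pblock mS.1 eS (x := x)) //.
  by rewrite !inE.
have mS1 : matching S1.
  split; last by move=> e; rewrite !inE => /andP[_]; apply: mS.2.
  by apply: trivIsetS mS.1; apply: subsetDl.
have uc1 : u \in cover S1.
  have [e eS' ue] := coverP _ _ uc; apply/coverP; exists e => //; rewrite !inE eS' andbT.
  by apply: contraTneq ue => ->; rewrite !inE negb_or uv.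
have vf e : e \in S1 -> v \notin e by move/dis; apply; rewrite set21.
have v'f e : e \in S1 -> v' \notin e by move/dis; apply; rewrite set22.
have cS : #|S| = #|S1|.+1 by rewrite (cardsD1 [set v; v']) eS.
have uvS1 : [set u; v] \notin S1 by rewrite !inE (negPf uvS) andbF.
have vv' : v != v' by rewrite eq_sym.
(* [H1] goes from [S1] to [S]; [H2] and [H3] go from [S1] to [[set u; v] |: S] by adding first [uv],
   then [vv']. *)
have H1 := nperm_pendant R v'f vv'.
have H2 := nperm_pendant R vf uv.
have v'f' e : e \in [set u; v] |: S1 -> v' \notin e.
  rewrite !inE => /orP[/eqP->|/andP[ne eS']]; first by rewrite !inE negb_or ![v' == _]eq_sym uv' vv'.
  by apply: v'f; rewrite !inE ne.
have H3 := nperm_pendant R v'f' vv'.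
have d0 : deg S1 v = 0%N.
  rewrite (deg_matching _ mS1); case: coverP => // -[e /vf /negPf ->] //.
have d1 : deg ([set u; v] |: S1) v = 1%N.
  rewrite /deg; suff -> : [set e in [set u; v] |: S1 | v \in e] = [set [set u; v]] by rewrite cards1.
  apply/setP=> e; rewrite !inE; case: eqP => [->|_] /=; first by rewrite !inE eqxx orbT.
  by apply/negP=> /andP[eS1]; apply/negP/vf; rewrite !inE.
move: H1 H2 H3; rewrite d0 d1 (deg_matching _ mS1) uc1 -SE cardsU1 uvS1 /= add1n.
rewrite setUCA -SE cS => H1 H2 H3.
have nk : p.+3%:R - #|S1|%:R != 0 :> R by rewrite subr_eq0 eqr_nat; lia.
apply: (mulfI nk).
rewrite -[2 * _ * _]mulrA H3.
transitivity (2 * ((p.+3%:R - #|S1|%:R) * nperm ([set u; v] |: S1))); first by ring.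
transitivity ((p.+3%:R - #|S1|%:R) * nperm S); last by ring.
by rewrite H2 H1; ring.
Qed.
End Matching.

(** * From orderings of the vertices to Hamiltonian cycles *)

Section HamSum.
Variables (R : realFieldType) (n : nat).

Definition perm_im (s : 'S_n) (C : {set {set 'I_n}}) : {set {set 'I_n}} :=
  [set [set s x | x in (e : {set 'I_n})] | e in C].

Lemma ham_edgesM (s t : 'S_n) : ham_edges (s * t)%g = perm_im t (ham_edges s).
Proof.
rewrite /perm_im /ham_edges -imset_comp; apply: eq_imset => i /=.
by rewrite imsetU1 imset_set1 !permM.
Qed.

Lemma perm_im_inj s : injective (perm_im s).
Proof. by do 2 apply: imset_inj; exact: perm_inj. Qed.

Definition ham_fiber : nat := #|[set s : 'S_n | ham_edges s == ham_edges 1]|.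

Lemma ham_fiber_gt0 : (0 < ham_fiber)%N.
Proof. by apply/card_gt0P; exists 1%g; rewrite inE. Qed.

(** Right multiplication by [t] relabels the vertices injectively, hence maps the orderings of the
    standard cycle onto those of [ham_edges t]. *)
Lemma card_ham_fiber (t : 'S_n) :
  #|[set s : 'S_n | ham_edges s == ham_edges t]| = ham_fiber.
Proof.
rewrite /ham_fiber -[RHS](card_imset _ (mulIg t)); apply: eq_card => s.
have E u : (ham_edges (u * t)%g == ham_edges t) = (ham_edges u == ham_edges 1).
  by rewrite -{2}(mul1g t) !ham_edgesM (inj_eq (@perm_im_inj t)).
apply/idP/imsetP => [|[u]]; rewrite inE => Es; last by rewrite inE => ->; rewrite E.
by exists (s * t^-1)%g; rewrite ?inE -?E mulgKV.
Qed.

Lemma sum_ham_edges (F : {set {set 'I_n}} -> R) :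
  \sum_(s : 'S_n) F (ham_edges s) = ham_fiber%:R * \sum_(C in ham_cycles n) F C.
Proof.
rewrite (partition_big (@ham_edges n) (mem (ham_cycles n))) /=; last first.
  by move=> s _; apply: imset_f.
rewrite mulr_sumr; apply: eq_bigr => C /imsetP[t _ ->].
under eq_bigr => s /eqP -> do over.
rewrite sumr_const mulr_natl -(card_ham_fiber t); congr (_ *+ _).
by apply: eq_card => s; rewrite !inE.
Qed.
End HamSum.

(** * Averaging over matchings of a cycle *)

(** Count complements. The lower index [#|T| - k] makes the binomial vanish when [k < #|A|], where
    the truncated [k - #|A|] would not. *)
Lemma card_supersets (T : finType) (A : {set T}) k : (k <= #|T|)%N ->
  #|[set J : {set T} | (#|J| == k) && (A \subset J)]| = 'C(#|T| - #|A|, #|T| - k).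
Proof.
move=> kT; rewrite -(card_imset _ (can_inj (@setCK T))).
have -> : (#|T| - #|A|)%N = #|~: A| by rewrite [RHS]cardsCs setCK.
rewrite -cards_draws; apply: eq_card => B; rewrite inE.
apply/imsetP/andP => [[J]|[BA /eqP Bk]].
  by rewrite inE => /andP[/eqP Jk AJ] ->; rewrite setCS AJ cardsCs setCK Jk.
exists (~: B); rewrite ?setCK // inE cardsCs setCK Bk subKn // eqxx /=.
by rewrite -(setCK A) setCS.
Qed.

Lemma eq_perm_inv (T : finType) (s : {perm T}) x y : (x == s y) = ((s^-1)%g x == y).
Proof. by rewrite -{1}(permKV s x) (inj_eq perm_inj). Qed.

Lemma half_eq_cases (x y : nat) : x./2 = y./2 ->
  x = y \/ y = x.+1 \/ x = y.+1.
Proof. by lia. Qed.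

Section Slots.
Variable p : nat.
Local Notation n := p.+4.
Local Notation m := (n./2).
Implicit Types (s : 'S_n) (J : {set 'I_m}).

(* [slot s j] is the edge between positions [2j] and [2j + 1] of the cycle [s]; the
   slots [j < n./2] form a maximum matching of that cycle. *)
Definition slot s (j : nat) : {set 'I_n} := [set x | ((s^-1)%g x)./2 == j].
Definition slots s J : {set {set 'I_n}} := [set slot s (val j) | j in J].
Definition covers J (i : 'I_n) : bool := [exists j in J, i./2 == val j].

Lemma slotE s (j : nat) : (j < m)%N ->
  slot s j = [set s (inord j.*2); s (inord j.*2 + 1)].
Proof.
rewrite gtn_half_double => jm.
have E : inord j.*2 + 1 = inord j.*2.+1 :> 'I_n.
  apply: val_inj; rewrite /= [(1 %% _)%N]modn_small // addn1.
  by rewrite !inordK ?modn_small //; lia.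
apply/setP=> x; rewrite !inE E !eq_perm_inv.
by rewrite -!val_eqE /= !inordK; lia.
Qed.

Lemma slot_inj s (i j : 'I_m) : slot s i = slot s j -> i = j.
Proof.
move=> E; have: s (inord i.*2) \in slot s j by rewrite -E slotE ?ltn_ord // set21.
have im := ltn_ord i; rewrite gtn_half_double in im.
by rewrite inE permK inordK; last lia; rewrite doubleK => /eqP/val_inj.
Qed.

Lemma card_slots s J : #|slots s J| = #|J|.
Proof. by rewrite card_imset // => i j /slot_inj. Qed.

Lemma slots_sub_ham s J : slots s J \subset ham_edges s.
Proof.
apply/subsetP=> _ /imsetP[j _ ->]; rewrite ham_edgesE slotE ?ltn_ord //.
by apply: imset_f.
Qed.

Lemma matching_slots s J : matching (slots s J).
Proof.
split; last first.
  move=> _ /imsetP[j _ ->]; rewrite slotE ?ltn_ord // cards2 (inj_eq perm_inj).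
  by rewrite -subr_eq0 opprD addrA subrr sub0r oppr_eq0 oner_eq0.
apply/trivIsetP=> _ _ /imsetP[i _ ->] /imsetP[j _ ->] ij.
rewrite disjoints_subset; apply/subsetP=> x; rewrite !inE => /eqP xi.
by apply: contra ij; rewrite xi => /eqP ->.
Qed.

Lemma mem_cover_slots s J i : (s i \in cover (slots s J)) = covers J i.
Proof.
apply/bigcupP/existsP => [[_ /imsetP[j jJ ->]]|[j /andP[jJ ij]]].
  by rewrite inE permK => ij; exists j; rewrite jJ.
by exists (slot s j); rewrite ?imset_f // inE permK.
Qed.

Lemma coversE J (i : 'I_n) (im : (i./2 < m)%N) : covers J i = (Ordinal im \in J).
Proof.
apply/existsP/idP => [[j /andP[jJ /eqP ij]]|iJ]; last by exists (Ordinal im); rewrite iJ /=.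
by rewrite (_ : Ordinal im = j) //; apply: val_inj.
Qed.

Lemma coversF J (i : 'I_n) : (m <= i./2)%N -> covers J i = false.
Proof.
move=> im; apply/existsP => -[j /andP[_ /eqP ij]].
by have := ltn_ord j; rewrite -ij ltnNge im.
Qed.

Lemma mem_slots s J i i' : i != i' ->
  ([set s i; s i'] \in slots s J) = (i./2 == i'./2) && covers J i.
Proof.
move=> ii'; apply/imsetP/andP => [[j jJ E]|[/eqP ii2 /existsP[j /andP[jJ /eqP ij]]]].
  have: s i \in slot s j by rewrite -E set21.
  have: s i' \in slot s j by rewrite -E set22.
  rewrite !inE !permK => /eqP -> ij; split=> //.
  by apply/existsP; exists j; rewrite jJ.
exists j => //; apply/setP=> x; rewrite !inE !eq_perm_inv.
move: ((s^-1)%g x) ii' => y; rewrite -!val_eqE /= -ij => ii'.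
by move: ii' ii2; case: (i : nat) (i' : nat) (y : nat); lia.
Qed.
End Slots.

Section Average.
Variables (R : realFieldType) (p k : nat).
Local Notation n := p.+4.
Local Notation m := (n./2).
Hypothesis km : (k <= m)%N.
Implicit Types (s : 'S_n) (J : {set 'I_m}).

(* The probability that a random Hamiltonian cycle uses [e], given that it
   contains [S]. *)
Definition cond (S : {set {set 'I_n}}) (e : {set 'I_n}) : R :=
  nperm R (e |: S) / nperm R S.

(** The conditional probability in terms of positions alone: the first branch is a chosen slot, the
    second the ratio given by [nperm_matching]. *)
Definition slot_weight J (i i' : 'I_n) : R :=
  if (i./2 == i'./2) && covers J i then 1
  else (2 - (covers J i)%:R) * (2 - (covers J i')%:R) / (2 * (p.+3%:R - k%:R)).

Lemma nperm_gt0 (S : {set {set 'I_n}}) s : S \subset ham_edges s -> 0 < nperm R S.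
Proof.
by move=> Ss; rewrite /nperm (bigD1 s) //= Ss ltr_pwDl // sumr_ge0.
Qed.

Lemma cond_slots s J i i' : #|J| = k -> i != i' ->
  cond (slots s J) [set s i; s i'] = slot_weight J i i'.
Proof.
move=> Jk ii'; have N0 := lt0r_neq0 (nperm_gt0 (slots_sub_ham s J)).
rewrite /cond /slot_weight -(mem_slots s) //; case: ifPn => [es|es].
  by rewrite (setUidPr _) ?sub1set // divff.
have := nperm_matching R (matching_slots s J) _ es.
rewrite card_slots Jk (inj_eq perm_inj) !mem_cover_slots => /(_ ii') H.
have c0 : p.+3%:R - k%:R != 0 :> R by rewrite subr_eq0 eqr_nat; lia.
have kn : (k < n)%N by move: km; lia.
have {}H := H kn.
move: c0 H; set c := _ - k%:R => c0 H; apply: (mulIf N0); rewrite divfK //.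
have c2 : 2 * c != 0 by rewrite mulf_neq0 ?pnatr_eq0.
by apply: (mulfI c2); rewrite H; field; rewrite c0.
Qed.

Definition avg_cond s e : R :=
  \sum_(r : 'I_n) \sum_(J : {set 'I_m} | #|J| == k) cond (slots (rot_perm r * s)%g J) e.

(** Rotating by [r] moves position [i] to [q = i - r], so summing over all [r] leaves a dependence
    on the offset [d] only. *)
Lemma avg_condE s i d : d != 0 ->
  avg_cond s [set s i; s (i + d)] =
  \sum_(q : 'I_n) \sum_(J : {set 'I_m} | #|J| == k) slot_weight J q (q + d).
Proof.
move=> d0; rewrite [RHS](reindex_inj (inj_comp (addrI i) oppr_inj)) /=.
apply: eq_bigr => r _; apply: eq_bigr => J /eqP Jk.
have E x : s (i + x) = (rot_perm r * s)%g (i - r + x).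
  by rewrite permM rot_permE addrA [r + _]addrC subrK.
have := E 0; rewrite !addr0 => ->; rewrite E cond_slots //.
by rewrite -subr_eq0 opprD addrA subrr sub0r oppr_eq0.
Qed.

Let cnt (a : nat) : R := 'C(m - a, m - k)%:R.

Lemma sum_covers0 : \sum_(J : {set 'I_m} | #|J| == k) 1 = cnt 0.
Proof.
have := @card_supersets _ (set0 : {set 'I_m}) k; rewrite card_ord cards0 /cnt => <- //.
by rewrite sumr_const; congr _%:R; apply: eq_card => J; rewrite !inE sub0set andbT.
Qed.

Lemma sum_covers1 i :
  \sum_(J : {set 'I_m} | #|J| == k) (covers J i)%:R = (i./2 < m)%:R * cnt 1.
Proof.
case: ltnP => im; last first.
  by rewrite mul0r big1 // => J _; rewrite coversF.
have := @card_supersets _ [set Ordinal im] k; rewrite card_ord cards1 /cnt mul1r => <- //.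
rewrite -sum1_card natr_sum [RHS]big_mkcond [LHS]big_mkcond; apply: eq_bigr => J _.
by rewrite inE sub1set coversE; case: eqP => //=; case: (_ \in J).
Qed.

Lemma sum_covers2 (i i' : 'I_n) : i./2 != i'./2 ->
  \sum_(J : {set 'I_m} | #|J| == k) (covers J i)%:R * (covers J i')%:R =
  (i./2 < m)%:R * (i'./2 < m)%:R * cnt 2.
Proof.
move=> ii'; case: (ltnP i./2 m) => im; last first.
  by rewrite !mul0r big1 // => J _; rewrite (coversF _ im) mul0r.
case: (ltnP i'./2 m) => i'm; last first.
  by rewrite mulr0 mul0r big1 // => J _; rewrite (coversF _ i'm) mulr0.
have := @card_supersets _ [set Ordinal im; Ordinal i'm] k.
rewrite card_ord cards2 -val_eqE /= ii' /cnt !mul1r => <- //.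
rewrite -sum1_card natr_sum [RHS]big_mkcond [LHS]big_mkcond; apply: eq_bigr => J _.
rewrite inE subUset !sub1set !coversE -natrM mulnb.
by case: eqP => //=; case: ifP => // ->.
Qed.

(** Positions at such an offset never share a slot, so the weight is always the product formula, and
    its sum turns out independent of [d]. *)
Lemma sum_slot_weight d : d != 0 -> d != 1 -> d != -1 ->
  \sum_(q : 'I_n) \sum_(J : {set 'I_m} | #|J| == k) slot_weight J q (q + d) =
  (4 * n%:R * cnt 0 - 8 * m%:R * cnt 1 + (4 * m%:R - n%:R) * cnt 2) / (2 * (p.+3%:R - k%:R)).
Proof.
move=> d0 d1 dN1.
(* [a q] tells whether position [q] lies in a slot; it fails only at the last position, for odd
   [n]. *)
pose a (q : 'I_n) : R := (q./2 < m)%:R.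
have nmE : n%:R = (odd n)%:R + 2 * m%:R :> R.
  by rewrite -[in LHS](odd_double_half n) natrD -mul2n natrM.
have aE q : a q = 1 - (odd n)%:R * (q == ord_max)%:R.
  rewrite /a -natrM mulnb -natr_negb; congr (_%:R); rewrite -val_eqE /=.
  by have := ltn_ord q; case: (q : nat) => [|x]; lia.
move: nmE aE; set M := m%:R; set N := n%:R; set o := (odd n)%:R => nmE aE.
have sum_a : \sum_q a q = 2 * M.
  under eq_bigr => q _ do rewrite aE.
  rewrite sumrB sumr_const card_ord -/N -mulr_sumr (bigD1 ord_max) //= eqxx big1.
    by rewrite addr0 mulr1 nmE; ring.
  by move=> q /negPf ->.
have sum_aD : \sum_q a (q + d) = 2 * M by rewrite -sum_a [RHS](reindex_inj (addIr d)).
(* At most one of the two positions is outside all slots, so the product is affine in [a]; this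
   removes the dependence on [d]. *)
have aM q : a q * a (q + d) = a q + a (q + d) - 1.
  have : (q == ord_max)%:R * (q + d == ord_max)%:R = 0 :> R.
    case: eqP => [->|_]; last by rewrite mul0r.
    by rewrite -subr_eq0 addrAC subrr add0r (negPf d0) mulr0.
  rewrite !aE; move: (q == _)%:R (q + d == _)%:R => x y xy.
  by transitivity (1 - o * x - o * y + o ^+ 2 * (x * y)); [ring | rewrite xy; ring].
have sum_aM : \sum_q a q * a (q + d) = 4 * M - N.
  under eq_bigr => q _ do rewrite aM.
  by rewrite sumrB big_split /= sumr_const card_ord -/N sum_a sum_aD; ring.
have half_neq (q : 'I_n) : q./2 != ((q + d)%R : 'I_n)./2.
  apply/eqP=> E.
  have: q + d = q + 1 \/ q = q + d + 1.
    have : q + d != q by rewrite -subr_eq0 addrAC subrr add0r.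
    move: (q + d) E => q' E /negP qq'.
    have succ (i j : 'I_n) : (j = i.+1 :> nat) -> j = i + 1.
      move=> ji; apply: val_inj; rewrite /= [(1 %% _)%N]modn_small // addn1 -ji.
      by rewrite modn_small.
    have [E'|[/succ|/succ]] := half_eq_cases E; [|by left|by right].
    by case: qq'; apply/eqP/val_inj.
  case=> [/addrI/eqP|qd]; first by rewrite (negPf d1).
  have /eqP : d + 1 = 0 by apply: (addrI q); rewrite addr0 addrA.
  by rewrite addr_eq0 (negPf dN1).
have E q : \sum_(J : {set 'I_m} | #|J| == k) slot_weight J q (q + d) =
   (4 * cnt 0 - 2 * a q * cnt 1 - 2 * a (q + d) * cnt 1 + a q * a (q + d) * cnt 2) /
   (2 * (p.+3%:R - k%:R)).
  transitivity ((4 * cnt 0 - 2 * (a q * cnt 1) - 2 * (a (q + d) * cnt 1) +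
      a q * a (q + d) * cnt 2) / (2 * (p.+3%:R - k%:R))); last by rewrite !mulrA.
  rewrite -sum_covers0 -(sum_covers2 (half_neq q)) -!sum_covers1.
  rewrite !mulr_sumr -!sumrB -big_split /= mulr_suml; apply: eq_bigr => J _.
  by rewrite /slot_weight (negPf (half_neq q)) /=; congr (_ / _); ring.
under eq_bigr => q _ do rewrite E.
rewrite -mulr_suml big_split /= !sumrB -!mulr_suml -!mulr_sumr sumr_const card_ord.
rewrite sum_aM sum_a sum_aD.
by congr (_ / _); rewrite -[_ *+ n]mulr_natl -/N; ring.
Qed.

Lemma sum_edge_ham s : \sum_(e : edge n) (val e \in ham_edges s)%:R = n%:R :> R.
Proof.
rewrite -natr_sum -big_mkcond sum1dep_card -(card_imset _ val_inj); congr (_%:R).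
transitivity #|ham_edges s|; last by rewrite ham_edgesE card_cyc //; apply: perm_inj.
apply: eq_card => e; apply/imsetP/idP => [[f]|es]; first by rewrite inE => ? ->.
have e2 := card_ham_edge es.
by exists (Sub e e2); rewrite ?inE.
Qed.

Lemma sum_cond (S : {set {set 'I_n}}) s :
  S \subset ham_edges s -> \sum_(e : edge n) cond S (val e) = n%:R.
Proof.
move=> Ss; have N0 := lt0r_neq0 (nperm_gt0 Ss).
rewrite /cond -mulr_suml; apply: (mulIf N0); rewrite divfK // /nperm exchange_big mulr_sumr.
apply: eq_bigr => t _; under eq_bigr => e _ do rewrite subUset sub1set -mulnb natrM.
by rewrite -mulr_suml sum_edge_ham.
Qed.

Lemma card_edge : #|{: edge n}|%:R = n%:R * p.+3%:R / 2 :> R.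
Proof.
have -> : #|{: edge n}| = 'C(n, 2).
  rewrite card_sig -[in RHS](card_ord n) -cardsT -cards_draws.
  by apply: eq_card => A; rewrite !inE subsetT.
have /(congr1 (fun x => x%:R : R)) : ('C(n, 2) * 2)%N = (n * p.+3)%N.
  by rewrite mulnC -mul_bin_diag bin1.
by rewrite !natrM => E; rewrite -E mulfK // pnatr_eq0.
Qed.

(* [1 - avg_coef] is the ratio of the mean of [cond] off the cycle, as given by
   [sum_slot_weight], to the barycenter's [2 / (n - 1)]; [a] is [avg_coef^-1]. *)
Definition avg_coef : R := 1 - p.+3%:R / (2 * n%:R * cnt 0) *
  ((4 * n%:R * cnt 0 - 8 * m%:R * cnt 1 + (4 * m%:R - n%:R) * cnt 2) / (2 * (p.+3%:R - k%:R))).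

Lemma avg_cond_formula s (e : edge n) :
  avg_cond s (val e) =
  n%:R * cnt 0 * ((1 - avg_coef) * (2 / p.+3%:R) + avg_coef * (val e \in ham_edges s)%:R).
Proof.
pose V : R := (4 * n%:R * cnt 0 - 8 * m%:R * cnt 1 + (4 * m%:R - n%:R) * cnt 2) /
  (2 * (p.+3%:R - k%:R)).
have bE : avg_coef = 1 - p.+3%:R / (2 * n%:R * cnt 0) * V by [].
(* The average is [V] off the cycle and [K] on it. [K] is not computed directly: it follows from the
   total over all edges, as every cycle has [n] edges. *)
pose K := \sum_(q : 'I_n) \sum_(J : {set 'I_m} | #|J| == k) slot_weight J q (q + 1).
have c0 : cnt 0 != 0 by rewrite pnatr_eq0 -lt0n bin_gt0; lia.
have n0 : n%:R != 0 :> R by rewrite pnatr_eq0.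
have p0 : p.+3%:R != 0 :> R by rewrite pnatr_eq0.
have EK (f : edge n) : avg_cond s (val f) = V + (K - V) * (val f \in ham_edges s)%:R.
  have /cards2P[x [y [xy ->]]] := valP f.
  rewrite -(permKV s x) -(permKV s y) in xy *.
  move: ((s^-1)%g x) ((s^-1)%g y) xy => i j; rewrite (inj_eq perm_inj) => ij.
  rewrite ham_edgesE; case: imsetP => [[q _ ->]|nq].
    by rewrite mulr1 addrC subrK avg_condE ?oner_eq0.
  rewrite mulr0 addr0 -(subrK i j) addrC avg_condE ?subr_eq0 1?eq_sym //.
  apply: sum_slot_weight; rewrite ?subr_eq0 1?eq_sym //.
    by apply: contra_not_neq nq => E; exists i => //; rewrite /cyc_edge E addrC subrK.
  apply: contra_not_neq nq => E; exists j => //.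
  by rewrite /cyc_edge setUC -[1]opprK E opprB addrC subrK.
have T : \sum_(f : edge n) avg_cond s (val f) = n%:R * cnt 0 * n%:R.
  rewrite exchange_big /=.
  under eq_bigr => r _.
    rewrite exchange_big /=.
    under eq_bigr => J _ do rewrite (sum_cond (slots_sub_ham _ J)).
    over.
  rewrite sumr_const card_ord -[LHS]mulr_natl -mulrA; congr (_ * _).
  by rewrite -sum_covers0 mulr_suml; apply: eq_bigr => J _; rewrite mul1r.
have : n%:R * (K - V) = n%:R * cnt 0 * n%:R - n%:R * p.+3%:R / 2 * V.
  rewrite -T; under eq_bigr => f _ do rewrite EK.
  by rewrite big_split /= sumr_const -[V *+ _]mulr_natl card_edge -mulr_sumr sum_edge_ham; ring.
move=> KV; rewrite EK.
move: avg_coef (n%:R : R) (p.+3%:R : R) (cnt 0) KV bE n0 p0 c0 => b N P c KV bE n0 p0 c0.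
have -> : K - V = N * c * b.
  by apply: (mulfI n0); rewrite KV bE; field; rewrite n0 c0.
by rewrite mulrDr mulrA; congr (_ + _); rewrite bE; field; rewrite n0 c0 p0.
Qed.
End Average.

(** * Size of the scaling constant *)

Lemma scaling_bound (R : realFieldType) (N K D : R) :
  0 < N -> 1 <= K -> 0 < D -> N ^+ 2 <= 10 * D ->
  `|N / K + N / K * ((K - 1) / D) - N / K| <= 10 / N.
Proof.
move=> N0 K1 D0 ND; have K0 : 0 < K by apply: lt_le_trans K1.
have E : N / K + N / K * ((K - 1) / D) - N / K = (1 - K^-1) * (N / D).
  by field; rewrite !gt_eqF.
have KV : 0 < K^-1 <= 1 by rewrite invr_gt0 K0 invf_le1.
have B : 0 <= N / D <= 10 / N.
  apply/andP; split; first by rewrite divr_ge0 ?ltW.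
  by rewrite ler_pdivrMr // mulrAC ler_pdivlMr // -expr2.
by rewrite E ger0_norm; nra.
Qed.

(** In each parity [b] simplifies to [K D / (N (D + K - 1))], whose inverse has the form required by
    [scaling_bound]; [D] is quadratic in [N], and [K <= M] with [9 <= N] gives
    [N ^+ 2 <= 10 * D]. *)
Lemma scaling_coef (R : realFieldType) (N K M b : R) :
  (N = 2 * M \/ N = 2 * M + 1) -> 9 <= N -> 1 <= K <= M ->
  b = 1 - (N - 1) / (2 * N) *
    ((4 * N - 8 * K + (4 * M - N) * (K * (K - 1) / (M * (M - 1)))) / (2 * (N - 1 - K))) ->
  b != 0 /\ `|b^-1 - N / K| <= 10 / N.
Proof.
move=> NM N9 /andP[K1 KM] bE.
have N0 : 0 < N by lra.
have K0 : 0 < K by lra.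
suff [D [D0 ND bD]] : exists D, [/\ 0 < D, N ^+ 2 <= 10 * D & b^-1 = N / K + N / K * ((K - 1) / D)].
  split; last by rewrite bD; apply: scaling_bound.
  rewrite -invr_eq0 bD gt_eqF // ltr_pwDl ?divr_gt0 // mulr_ge0 ?divr_ge0 //; lra.
case: NM => NM.
  exists (N ^+ 2 - (K + 3) * N + K + 3).
  have D2 : 0 < N ^+ 2 - (K + 3) * N + K + 3 by nra.
  split => //; first by nra.
  rewrite bE; have -> : M = N / 2 by lra.
  have h : (N - 2) * (N - K - 1) = (N ^+ 2 - (K + 3) * N + K + 3) + (K - 1) by ring.
  transitivity ((K * (N ^+ 2 - (K + 3) * N + K + 3)) / (N * ((N - 2) * (N - K - 1))))^-1.
    congr (_^-1); field; rewrite !gt_eqF; lra.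
  rewrite h; field; rewrite !gt_eqF //; nra.
exists ((N - 2) * (N - K - 2)); have D2 : 0 < (N - 2) * (N - K - 2) by nra.
split => //; first by nra.
rewrite bE; have -> : M = (N - 1) / 2 by lra.
transitivity ((K * ((N - 2) * (N - K - 2))) / (N * ((N - K - 1) * (N - 3))))^-1.
  congr (_^-1); field; rewrite !gt_eqF; lra.
have -> : (N - K - 1) * (N - 3) = (N - 2) * (N - K - 2) + (K - 1) by ring.
field; rewrite !gt_eqF //; nra.
Qed.

(** * Farkas' lemma *)

Section Farkas.
Variables (R : realFieldType) (I : finType).
Implicit Types u v x y : I -> R.

Definition dot u v : R := \sum_i u i * v i.

Lemma dotC u v : dot u v = dot v u.
Proof. by apply: eq_bigr => i _; rewrite mulrC. Qed.

Lemma dot_subZl u v x c : dot (fun i => u i - c * v i) x = dot u x - c * dot v x.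
Proof.
rewrite /dot mulr_sumr -sumrB; apply: eq_bigr => i _.
by rewrite mulrBl mulrA.
Qed.

Lemma dot_subZr u v x c : dot x (fun i => u i - c * v i) = dot x u - c * dot x v.
Proof. by rewrite dotC dot_subZl !(dotC x). Qed.

(* Bartl's induction: if [x0] violates the conclusion for the shorter list [s], it
   is strictly separated by [a j0]; projecting along [x0] makes [a j0] vanish. *)
Lemma farkas_seq (J : eqType) (s : seq J) (a : J -> I -> R) (b : I -> R) :
  uniq s ->
  (forall x, (forall j, j \in s -> 0 <= dot (a j) x) -> 0 <= dot b x) ->
  exists2 l : J -> R, (forall j, 0 <= l j) &
    forall i, b i = \sum_(j <- s) l j * a j i.
Proof.
elim: s a b => [|j0 s IH] a b /=.
  move=> _ H; exists (fun _ => 0) => // i; rewrite big_nil.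
  (* Without constraints, testing at [-b] gives [- dot b b >= 0], so [b] is zero. *)
  have /(_ _)/wrap[] // := H (fun i => 0 - 1 * b i).
  have -> : dot b (fun i => 0 - 1 * b i) = - \sum_k b k * b k.
    by rewrite -sumrN; apply: eq_bigr => k _; rewrite sub0r mul1r mulrN.
  rewrite oppr_ge0 => b0; apply/eqP; rewrite -[_ == _]orbb -mulf_eq0; apply/eqP.
  have sq k : true -> 0 <= b k * b k by rewrite -expr2 sqr_ge0.
  by apply: (psumr_eq0P sq) => //; apply/le_anti; rewrite b0 sumr_ge0.
case/andP=> j0s us H.
have [K|/existsNP[x0 /not_implyP[x0s /negP]]] :=
  EM (forall x, (forall j, j \in s -> 0 <= dot (a j) x) -> 0 <= dot b x).
  have [l l0 bl] := IH a b us K.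
  exists (fun j => if j == j0 then 0 else l j) => [j|i]; first by case: ifP.
  rewrite big_cons eqxx mul0r add0r bl; apply: eq_big_seq => j js.
  by case: eqP js j0s => // -> ->.
rewrite -ltNge => bx0.
have t0 : dot (a j0) x0 < 0.
  rewrite ltNge; apply: contraL bx0 => t0; rewrite -leNgt; apply: H => j.
  by rewrite inE => /predU1P[->|/x0s].
set t := dot (a j0) x0 in t0.
have [l l0 bl] : exists2 l : J -> R, (forall j, 0 <= l j) &
    forall i, b i - dot b x0 / t * a j0 i =
      \sum_(j <- s) l j * (a j i - dot (a j) x0 / t * a j0 i).
  apply: (IH (fun j i => a j i - dot (a j) x0 / t * a j0 i)
             (fun i => b i - dot b x0 / t * a j0 i) us) => x xs.
  (* Projecting the functional is adjoint to projecting the point along [x0] into the kernel of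
     [a j0], where the constraint [j0] holds trivially. *)
  have E u : dot (fun i => u i - dot u x0 / t * a j0 i) x =
             dot u (fun i => x i - dot (a j0) x / t * x0 i).
    by rewrite dot_subZl dot_subZr; ring.
  rewrite E; apply: H => j; rewrite inE => /predU1P[->|js].
    by rewrite dot_subZr -/t divfK ?subrr // lt_eqF.
  by rewrite -E; apply: xs.
(* [c] collects the multiples of [a j0] removed by the projection. It is non-negative since [t] and
   [dot b x0] are negative while each [dot (a j) x0] is not. *)
pose c := dot b x0 / t - \sum_(j <- s) l j * (dot (a j) x0 / t).
exists (fun j => if j == j0 then c else if j \in s then l j else 0) => [j|i].
  case: eqP => _; last by case: ifP.
  rewrite subr_ge0 (@le_trans _ _ 0) //; last by rewrite ltW // nmulr_rgt0 // invr_lt0.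
  rewrite big_seq sumr_le0 // => k ks; rewrite mulr_ge0_le0 // mulr_ge0_le0 //; first exact: x0s.
  by rewrite invr_le0 ltW.
rewrite big_cons eqxx (eq_big_seq (fun j => l j * a j i)); last first.
  by move=> j js; rewrite js; case: eqP js j0s => // -> ->.
rewrite -[b i](subrK (dot b x0 / t * a j0 i)) bl /c.
suff -> : \sum_(j <- s) l j * (a j i - dot (a j) x0 / t * a j0 i) =
    \sum_(j <- s) l j * a j i - (\sum_(j <- s) l j * (dot (a j) x0 / t)) * a j0 i by ring.
by rewrite mulr_suml -sumrB; apply: eq_bigr => j _; ring.
Qed.

Lemma farkas (J : finType) (A : {pred J}) (a : J -> I -> R) (b : I -> R) :
  (forall x, (forall j, j \in A -> 0 <= dot (a j) x) -> 0 <= dot b x) ->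
  exists2 l : J -> R, (forall j, 0 <= l j) &
    forall i, b i = \sum_(j in A) l j * a j i.
Proof.
move=> H; have [|x xA|l l0 bl] := @farkas_seq _ (enum A) a b; first exact: enum_uniq.
  by apply: H => j jA; apply: xA; rewrite mem_enum.
by exists l => // i; rewrite bl big_enum.
Qed.
End Farkas.

(** * The polytope *)

Section Polytope.
Variables (R : realType) (p : nat).
Local Notation n := p.+4.
Local Notation edge := (edge n).
Local Notation X := (ham_cycles n).
Local Notation incid := (@incid R n).
Implicit Types (S C : {set {set 'I_n}}) (c z : edge -> R).

Lemma card_ham_cycles_gt0 : 0 < #|X|%:R :> R.
Proof. by rewrite ltr0n; apply/card_gt0P; exists (ham_edges 1); apply: imset_f. Qed.

Lemma nperm_cycles S : nperm R S = (ham_fiber n)%:R * \sum_(C in X) (S \subset C)%:R.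
Proof. exact: (sum_ham_edges (fun C => (S \subset C)%:R : R)). Qed.

(** The product of the variables in [S]; on [X] it is the indicator of [S \subset C], hence equal to
    its own square. *)
Definition edge_monomial S : {mpoly R[#|{: edge}|]} :=
  'X_[[multinom (val (enum_val i) \in S : nat) | i < #|{: edge}|]].

Lemma peval_edge_monomial S C : (forall e, e \in S -> #|e| == 2%N) ->
  peval (edge_monomial S) (incid C) = (S \subset C)%:R.
Proof.
move=> S2; rewrite /peval mevalX.
transitivity (\prod_(e : edge) ((val e \in S) ==> (val e \in C))%:R : R).
  rewrite [RHS](reindex (@enum_val _ (mem {: edge}))) /=; last first.
    by apply: onW_bij; apply: enum_val_bij.
  apply: eq_bigr => i _; rewrite mnmE /Defs.incid.
  by case: (_ \in S); case: (_ \in C); rewrite ?expr0 ?expr1.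
case: (boolP (S \subset C)) => [/subsetP SC|/subsetPn[e eS eC]].
  by rewrite big1 // => e _; case: (boolP (_ \in S)) => //= /SC ->.
have [f fe] : exists f : edge, val f = e by exists (Sub e (S2 e eS)).
by rewrite (bigD1 f) // fe eS (negPf eC) [LHS]mul0r.
Qed.

Lemma msize_edge_monomial S : (msize (edge_monomial S) <= #|S|.+1)%N.
Proof.
rewrite msizeX mdegE ltnS.
under eq_bigr => i _ do rewrite mnmE.
have -> : (\sum_(i < #|{: edge}|) (val (enum_val i : edge) \in S) =
    \sum_(e : edge) (val e \in S))%N.
  rewrite [RHS](reindex (@enum_val _ (mem {: edge}))) //.
  by apply: onW_bij; apply: enum_val_bij.
rewrite -big_mkcond sum1dep_card -(card_imset _ val_inj); apply: subset_leq_card.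
by apply/subsetP=> _ /imsetP[e + ->]; rewrite inE.
Qed.

(** Up to a positive factor the right-hand side is [qform] at [edge_monomial S], whose degree is at
    most [k]. *)
Lemma in_Pk_cond k c S (s : 'S_n) : in_Pk k c -> S \subset ham_edges s -> (#|S| <= k)%N ->
  0 <= \sum_e c e * cond R S (val e).
Proof.
move=> [_ psd] Ss Sk; have N0 := nperm_gt0 R Ss.
have S2 e : e \in S -> #|e| == 2%N by move/(subsetP Ss)/card_ham_edge.
have := psd _ (leq_trans (msize_edge_monomial S) _); rewrite ltnS => /(_ Sk).
rewrite /qform /avgX pmulr_rge0 ?invr_gt0 ?card_ham_cycles_gt0 // => H.
have E e : nperm R (val e |: S) =
    (ham_fiber n)%:R * \sum_(C in X) (S \subset C)%:R * (val e \in C)%:R.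
  rewrite nperm_cycles; congr (_ * _); apply: eq_bigr => C _.
  by rewrite subUset sub1set -mulnb natrM mulrC.
have -> : \sum_e c e * cond R S (val e) = (ham_fiber n)%:R / nperm R S *
    \sum_(C in X) linf c (incid C) * (peval (edge_monomial S) (incid C)) ^+ 2.
  under [X in _ = _ * X]eq_bigr => C _ do rewrite peval_edge_monomial // /linf mulr_suml.
  rewrite exchange_big mulr_sumr; apply: eq_bigr => e _.
  rewrite /cond E !mulr_sumr !mulr_suml mulr_sumr; apply: eq_bigr => C _.
  by rewrite /Defs.incid; case: (S \subset C); rewrite ?expr1n ?expr0n /=; ring.
by rewrite mulr_ge0 // divr_ge0 // ltW.
Qed.

(** This is [nperm_pendant] for the empty set. *)
Lemma Zbar_avg (e : edge) : Zbar R n e = \sum_(C in X) #|X|%:R^-1 * incid C e.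
Proof.
have /cards2P[u [v [uv ee]]] := valP e.
have E0 x : x \in (set0 : {set {set 'I_n}}) -> v \notin x by rewrite inE.
have := nperm_pendant R E0 uv; rewrite cards0 subr0 setU0 -ee.
have -> : deg (set0 : {set {set 'I_n}}) u = 0%N.
  by apply/eqP; rewrite cards_eq0; apply/eqP/setP=> x; rewrite !inE.
rewrite subr0 !nperm_cycles.
under eq_bigr => C _ do rewrite sub1set.
under [in X in _ = X -> _]eq_bigr => C _ do rewrite sub0set.
rewrite sumr_const mulrCA [in X in _ = X -> _]mulrCA.
have F0 : (ham_fiber n)%:R != 0 :> R by rewrite pnatr_eq0 -lt0n ham_fiber_gt0.
have X0 := lt0r_neq0 card_ham_cycles_gt0.
have p0 : p.+3%:R != 0 :> R by rewrite pnatr_eq0.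
move=> /(mulfI F0) H; rewrite -mulr_sumr; apply: (mulfI p0); rewrite [RHS]mulrCA H /Zbar /=.
by rewrite mulrCA mulfV // mulr1 mulrCA mulVf ?mulr1.
Qed.

Lemma in_aff_shrink z b : in_Tn z ->
  in_aff (fun e => Zbar R n e + b * (z e - Zbar R n e)).
Proof.
move=> [lam [_ [lam1 zE]]]; exists (fun C => (1 - b) * #|X|%:R^-1 + b * lam C); split.
  rewrite big_split /= -!mulr_sumr lam1 sumr_const -[_ *+ _]mulr_natr.
  by rewrite mulVf ?gt_eqF ?card_ham_cycles_gt0 //; ring.
move=> e; rewrite zE Zbar_avg; under [RHS]eq_bigr => C _ do rewrite mulrDl -!mulrA.
by rewrite big_split /= -!mulr_sumr; ring.
Qed.

Lemma linf_shrink_ge0 k c z : (1 <= k <= n./2)%N -> in_Pk k c -> in_Tn z ->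
  0 <= linf c (fun e => Zbar R n e + avg_coef R p k * (z e - Zbar R n e)).
Proof.
move=> /andP[k1 kn] Pc [lam [lam0 [lam1 zE]]].
set b := avg_coef R p k.
have -> : linf c (fun e => Zbar R n e + b * (z e - Zbar R n e)) =
    \sum_(C in X) lam C * linf c (fun e => (1 - b) * Zbar R n e + b * incid C e).
  under [RHS]eq_bigr => C _ do rewrite /linf mulr_sumr.
  rewrite exchange_big /=; apply: eq_bigr => e _.
  under [RHS]eq_bigr => C _ do rewrite mulrCA mulrDr (mulrCA _ b).
  by rewrite -mulr_sumr big_split /= -mulr_suml lam1 -mulr_sumr -zE; ring.
apply: sumr_ge0 => C CX; rewrite mulr_ge0 ?lam0 //; have /imsetP[s _ ->] := CX.
(* [w] is the number of pairs [(r, J)] averaged over; it undoes the missing normalisation of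
   [avg_cond]. *)
pose w : R := n%:R * 'C(n./2 - 0, n./2 - k)%:R.
have w0 : 0 < w by rewrite mulr_gt0 ?ltr0n // bin_gt0 subn0 leq_subr.
rewrite -(pmulr_rge0 _ w0).
have -> : w * linf c (fun e => (1 - b) * Zbar R n e + b * incid (ham_edges s) e) =
    \sum_e c e * avg_cond R k s (val e).
  rewrite /linf mulr_sumr; apply: eq_bigr => e _.
  by rewrite (avg_cond_formula R kn) mulrCA.
under eq_bigr => e _ do rewrite /avg_cond mulr_sumr.
rewrite exchange_big sumr_ge0 // => r _.
under eq_bigr => e _ do rewrite mulr_sumr.
rewrite exchange_big sumr_ge0 // => J /eqP Jk.
by apply: (in_Pk_cond Pc (slots_sub_ham _ J)); rewrite card_slots Jk.
Qed.

Lemma linf_ones C : C \in X -> linf (fun _ => 1) (incid C) = n%:R.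
Proof.
by move=> /imsetP[s _ ->]; rewrite -(sum_edge_ham R s); apply: eq_bigr => e _; rewrite mul1r.
Qed.

Lemma polar_sub_Tn k (y : edge -> R) : in_Pk_polar k y -> in_Tn y.
Proof.
move=> [[mu [mu1 yE]] yP].
have linfE c : linf c y = \sum_(C in X) mu C * linf c (incid C).
  under [RHS]eq_bigr => C _ do rewrite /linf mulr_sumr.
  rewrite exchange_big /=; apply: eq_bigr => e _.
  by rewrite yE mulr_sumr; apply: eq_bigr => C _; rewrite mulrCA.
have [c H|lam lam0 yl] := @farkas R edge _ (mem X) incid y.
  have {}H C : C \in X -> 0 <= linf c (incid C) by move=> /H; rewrite dotC.
  rewrite dotC; change (0 <= linf c y).
  pose g := avgX (linf c).
  have g0 : 0 <= g by rewrite /g /avgX mulr_ge0 ?invr_ge0 ?ler0n ?sumr_ge0.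
  (* A functional of average zero that is non-negative on [X] vanishes there, hence at [y], which is
     in the affine span. Otherwise it can be normalised into [P_k]. *)
  have [g_eq0|g_neq0] := eqVneq g 0.
    rewrite linfE big1 // => C CX; rewrite (psumr_eq0P H) ?mulr0 //.
    by move/eqP: g_eq0; rewrite /g /avgX mulf_eq0 invr_eq0 gt_eqF ?card_ham_cycles_gt0 //= => /eqP.
  have scale x : linf (fun e => g^-1 * c e) x = g^-1 * linf c x.
    by rewrite /linf mulr_sumr; apply: eq_bigr => e _; rewrite mulrA.
  have gt0 : 0 < g^-1 by rewrite invr_gt0 lt0r g_neq0.
  rewrite -(pmulr_rge0 _ gt0) -scale; apply: yP; split.
    rewrite /avgX; under eq_bigr => C _ do rewrite scale.
    by rewrite -mulr_sumr mulrCA mulVf.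
  move=> h _; rewrite /qform /avgX mulr_ge0 ?invr_ge0 ?ler0n // sumr_ge0 // => C CX.
  by rewrite mulr_ge0 ?sqr_ge0 // scale mulr_ge0 ?H // ltW.
exists lam; split; [by []|split; last by []].
(* The Farkas coefficients sum to [1] because the all-ones functional equals [n] on [X], hence on
   its affine span. *)
have n0 : n%:R != 0 :> R by rewrite pnatr_eq0.
apply: (mulIf n0); rewrite mul1r; transitivity (linf (fun _ => 1) y).
  rewrite /linf; under [RHS]eq_bigr => e _ do rewrite mul1r yl.
  rewrite exchange_big mulr_suml; apply: eq_bigr => C CX.
  by rewrite -(linf_ones CX) -mulr_sumr; congr (_ * _); apply: eq_bigr => e _; rewrite mul1r.
rewrite linfE (eq_bigr (fun C => mu C * n%:R)); last by move=> C CX; rewrite linf_ones.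
by rewrite -mulr_suml mu1 mul1r.
Qed.
End Polytope.

(** * The two inclusions and the constant *)

Theorem theorem2 (R : realType) (n k : nat) :
  (9 <= n)%N -> (1 <= k <= n./2)%N ->
  exists a : R,
    `|a - n%:R / k%:R| <= 10 / n%:R /\
    (forall y : edge n -> R, in_Pk_polar k y ->
       exists t, in_Tn t /\ forall e, y e - Zbar R n e = t e - Zbar R n e) /\
    (forall z : edge n -> R, in_Tn z ->
       exists w, in_Pk_polar k w /\
         forall e, z e - Zbar R n e = a * (w e - Zbar R n e)).
Proof.
case: n => [|[|[|[|p]]]] // n9 kn; set b := avg_coef R p k.
have [b0 ab] : b != 0 /\ `|b^-1 - p.+4%:R / k%:R| <= 10 / p.+4%:R.
  have m1 : (1 < p.+4./2)%N by lia.
  apply: (@scaling_coef _ p.+4%:R k%:R (p.+4./2)%:R b).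
  - have := odd_double_half p.+4; move: (odd _) (half _) => o m.
    move=> /(congr1 (fun x => x%:R : R)) <-; rewrite natrD -mul2n natrM.
    by case: o => /=; [right; rewrite addrC|left; rewrite add0r].
  - by rewrite (ler_nat _ 9).
  - by rewrite ler1n ler_nat.
  rewrite /b /avg_coef; move: m1 kn; set m := p.+4./2 => m1 /andP[k1 km].
  have C0 : 'C(m - 0, m - k)%:R != 0 :> R by rewrite pnatr_eq0 -lt0n bin_gt0 subn0 leq_subr.
  (* Absorption identities: the fractions of sets [J] through one and two given slots are [k / m]
     and [k (k - 1) / (m (m - 1))], as [scaling_coef] expects. *)
  have E1 : m%:R * 'C(m - 1, m - k)%:R = k%:R * 'C(m - 0, m - k)%:R :> R.
    by rewrite -!natrM subn0 subn1 mul_bin_down subKn.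
  have E2 : (m%:R - 1) * 'C(m - 2, m - k)%:R = (k%:R - 1) * 'C(m - 1, m - k)%:R :> R.
    have <- : (m - 1)%:R = m%:R - 1 :> R by rewrite natrB // ltnW.
    have <- : (k - 1)%:R = k%:R - 1 :> R by rewrite natrB.
    rewrite -!natrM subn2 !subn1 mul_bin_down.
    by rewrite -[in LHS](subn1 m) subnAC subKn // subn1.
  have m0 : m%:R != 0 :> R by rewrite pnatr_eq0 -lt0n ltnW.
  have m10 : m%:R - 1 != 0 :> R by rewrite subr_eq0 (eqr_nat R m 1) gtn_eqF.
  have n0 : p.+4%:R != 0 :> R by rewrite pnatr_eq0.
  have P3 : p.+3%:R = p.+4%:R - 1 :> R by rewrite -[p.+4]addn1 natrD addrK.
  have kn : p.+4%:R - 1 - k%:R != 0 :> R.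
    rewrite -P3 subr_eq0 eqr_nat; move: km; rewrite /m; lia.
  rewrite P3.
  move: ('C(m - 0, _)%:R) ('C(m - 1, _)%:R) ('C(m - 2, _)%:R) C0 E1 E2 => c0 c1 c2 C0 E1 E2.
  have -> : c2 = k%:R * (k%:R - 1) / (m%:R * (m%:R - 1)) * c0.
    apply: (mulfI (mulf_neq0 m0 m10)); rewrite -mulrA E2 mulrCA E1; field.
    by rewrite m0 m10.
  have -> : 8 * m%:R * c1 = 8 * k%:R * c0 by rewrite -mulrA E1 mulrA.
  move: (p.+4%:R : R) (m%:R : R) (k%:R : R) m0 m10 n0 kn => N M K m0 m10 n0 kn.
  by field; rewrite m0 m10 n0 kn C0.
exists b^-1; split=> //; split=> [y /polar_sub_Tn ty|z tz]; first by exists y.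
exists (fun e => Zbar R p.+4 e + b * (z e - Zbar R p.+4 e)); split.
  by split=> [|c Pc]; [apply: in_aff_shrink|apply: linf_shrink_ge0].
by move=> e; rewrite [Zbar _ _ _ + _]addrC addrK mulKf.
Qed.
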